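(* Let $p$ be a prime and let $G=\mathcal{P}(\mathbb{Z}_{p}\times \mathbb{Z}_{p^{2}})$ be the power graph of the group $\mathbb{Z}_{p}\times \mathbb{Z}_{p^{2}}$ (a graph on $p^3$ vertices). Then the distance Laplacian characteristic polynomial of $G$ is, up to the sign $(-1)^{p^3}$, \[ x(x-p^{3})(x-2p^{3}+p)^{p^{2}-p-1}(x-p^{3}-p^{2}+p)^{p-1}(x-2p^{3}+p^{2})^{p(p^{2}-p-1)}(x-2p^{3}+1)^{p}; \] equivalently, $\det(xI-D^L(G))$ equals this polynomial.
   Context: $\mathbb{Z}_m$ denotes the cyclic group of integers modulo $m$. The (undirected) power graph $\mathcal{P}(\mathcal{G})$ of a finite group $\mathcal{G}$ has vertex set $\mathcal{G}$, and two distinct elements $x,y$ are adjacent iff $y=x^{i}$ or $x=y^{j}$ for some positive integers $i,j$. For a connected graph $G$ with vertices $v_1,\dots,v_n$, $D(G)=(d(v_i,v_j))$ is the distance matrix, $Tr(v_i)=\sum_j d(v_i,v_j)$ is the transmission of $v_i$, $Tr(G)=\mathrm{diag}(Tr(v_1),\dots,Tr(v_n))$, and the distance Laplacian matrix is $D^L(G)=Tr(G)-D(G)$. The paper defines the distance Laplacian characteristic polynomial as $\det(D^L(G)-xI_n)$. *)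

(* Defs.v *)
From mathcomp Require Import all_boot all_order all_algebra all_fingroup.

Set Implicit Arguments.
Unset Strict Implicit.
Unset Printing Implicit Defensive.

Import GRing.Theory.

Local Open Scope ring_scope.

(* A simple graph on a finType T is given by its adjacency relation e : rel T. *)

Section PowerGraph.
Local Open Scope group_scope.
Variable gT : finGroupType.
Implicit Types x y : gT.

(* Exponents 1, ..., #[x] exhaust all positive powers of x; see pos_powerP. *)
Definition pos_power x y : bool := [exists i : 'I_#[x], y == x ^+ i.+1].

Lemma pos_powerP x y :
  reflect (exists2 i : nat, (0 < i)%N & y = x ^+ i) (pos_power x y).
Proof.
apply: (iffP existsP) => [[i /eqP ->]|[[//|i] _ ->]]; first by exists i.+1.
have lti : (i %% #[x] < #[x])%N by rewrite ltn_mod order_gt0.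
by exists (Ordinal lti); rewrite /= !expgS expg_mod_order.
Qed.

Definition power_graph : rel gT :=
  [rel x y | (x != y) && (pos_power x y || pos_power y x)].

Lemma power_graph_sym : symmetric power_graph.
Proof. by move=> x y; rewrite /power_graph /= [x == y]eq_sym orbC. Qed.

Lemma power_graph_irrefl : irreflexive power_graph.
Proof. by move=> x; rewrite /power_graph /= eqxx. Qed.

Lemma power_graph_connected x y : connect power_graph x y.
Proof.
have to1 z : connect power_graph z 1.
  have [-> // | nz1] := eqVneq z 1.
  apply: connect1; rewrite /power_graph /= nz1 /=; apply/orP; left; apply/pos_powerP.
  by exists #[z]; rewrite ?order_gt0 ?expg_order.
apply: connect_trans (to1 x) _.
by rewrite (sym_connect_sym power_graph_sym).
Qed.

End PowerGraph.

Section Distance.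
Variables (T : finType) (e : rel T).

Definition has_walk (x y : T) (n : nat) : bool :=
  [exists w : n.-tuple T, path e x w && (last x w == y)].

(* The least length of a walk from x to y; the junk value #|T| is taken when  *)
(* x and y are not connected.                                                 *)
Definition gdist (x y : T) : nat := find (has_walk x y) (iota 0 #|T|).

Lemma gdist_walk x y : connect e x y ->
  exists w : seq T, [/\ path e x w, last x w = y & size w = gdist x y].
Proof.
case/connectP=> w0 w0P ->; case/shortenP: w0P => w wP wU _.
have hw : has (has_walk x (last x w)) (iota 0 #|T|).
  apply/hasP; exists (size w).
    by rewrite mem_iota /= add0n; have := card_uniqP wU => /= <-; apply: max_card.
  by apply/existsP; exists (in_tuple w); rewrite wP /=.
have := nth_find 0%N hw; rewrite -/(gdist _ _) nth_iota; last first.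
  by move: hw; rewrite has_find size_iota.
case/existsP=> t /andP[tP /eqP tl]; exists t; split=> //.
by rewrite size_tuple.
Qed.

Lemma gdist_min x y (w : seq T) :
  path e x w -> last x w = y -> (gdist x y <= size w)%N.
Proof.
move=> wP wl; rewrite leqNgt; apply/negP => lt_w.
have lt_wT : (size w < #|T|)%N.
  by apply: leq_trans lt_w _; rewrite -[leqRHS](size_iota 0) find_size.
have := before_find 0%N lt_w; rewrite nth_iota // add0n => /negbT/negP[].
by apply/existsP; exists (in_tuple w); rewrite wP wl /=.
Qed.

Definition transmission (x : T) : nat := (\sum_(y : T) gdist x y)%N.

Definition dist_mx : 'M[int]_#|T| :=
  \matrix_(i, j) (gdist (enum_val i) (enum_val j))%:Z.

Definition transmission_mx : 'M[int]_#|T| :=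
  diag_mx (\row_i (transmission (enum_val i))%:Z).

Definition dist_laplacian : 'M[int]_#|T| := transmission_mx - dist_mx.

(* The convention det (D^L - x I), which differs from char_poly               *)
(* by the sign (-1) ^+ #|T|.                                                  *)
Definition dist_laplacian_char_poly : {poly int} :=
  \det (map_mx polyC dist_laplacian - 'X%:M).

End Distance.

(* Main.v *)
(* Elements generating the same cyclic subgroup are twins in the power graph, *)
(* which has diameter 2, so the distance Laplacian matrix is                  *)
(* delta(x, y) tr(cl x) - w(cl x, cl y), where w = 1 for comparable cyclic    *)
(* subgroups and w = 2 otherwise.  For twins x, y of class k, e_x - e_y is an *)
(* eigenvector with eigenvalue tr k; functions constant on the classes carry  *)
(* the remaining eigenvectors.  The comparability order of the cyclic         *)
(* subgroups is a tree: the trivial group lies below a subgroup C and p other *)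
(* subgroups B_i of order p, and C lies below p subgroups E_j of order p ^ 2. *)
(* Eigenvectors on the classes are read off this tree, and an eigenbasis with *)
(* nonzero determinant determines the characteristic polynomial over int.     *)

Require Import Defs.
From mathcomp Require Import all_boot all_order all_algebra all_fingroup.
From mathcomp Require Import ring zify.

Set Implicit Arguments.
Unset Strict Implicit.
Unset Printing Implicit Defensive.

Import GRing.Theory.
Local Open Scope ring_scope.

(** Write n = p ^ 3. By [char_poly_class_laplacian], a class k of size N contributes the eigenvalue
    [tr k] N - 1 times through twin differences, and one more eigenvalue through the class
    functions. By [comparable_classP] adjacency follows the tree of cyclic subgroups; the classes 1,
    C, B_i, E_j have sizes 1, p - 1, p - 1, p (p - 1), and [class_eigenfunP] with
    [class_eigenfun_inj] supplies 2 p + 2 independent class eigenfunctions.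

    Thus 2 n - p arises p - 2 times in each B_i and p - 1 times from differences of the E_j, in all
    p ^ 2 - p - 1 times; n + p ^ 2 - p arises p - 2 times in C and once from separating C from the
    E_j; 2 n - p ^ 2 comes from twins in the E_j; 2 n - 1, n and 0 come from class functions. *)

Lemma char_poly_eigenbasis (R : idomainType) (T : finType)
    (A V : T -> T -> R) (lam : T -> R) :
  (forall x z, \sum_y A z y * V x y = lam x * V x z) ->
  (forall u : T -> R, (forall x, \sum_y u y * V x y = 0) -> forall y, u y = 0) ->
  char_poly (\matrix_(i, j) A (enum_val i) (enum_val j) : 'M_#|T|) =
    \prod_x ('X - (lam x)%:P).
Proof.
move=> eigV injV; set M := \matrix_(i, j) _.
pose P : 'M[R]_#|T| := \matrix_(i, j) V (enum_val j) (enum_val i).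
pose D : 'M[R]_#|T| := diag_mx (\row_i lam (enum_val i)).
have MP : M *m P = P *m D.
  apply/matrixP=> i j; rewrite mul_mx_diag !mxE mulrC -eigV.
  rewrite (reindex (fun k : 'I_#|T| => enum_val k)) /=; last exact/onW_bij/enum_val_bij.
  by apply: eq_bigr => k _; rewrite !mxE.
have detP : \det P != 0.
  apply/det0P=> -[v nz_v vP0]; case/negP: nz_v; apply/eqP/rowP=> j.
  rewrite mxE -[j]enum_valK.
  apply: (injV (fun x => v 0 (enum_rank x))) => x.
  have /rowP/(_ (enum_rank x)) := vP0; rewrite !mxE => E; rewrite -[RHS]E {E}.
  rewrite (reindex (fun k : 'I_#|T| => enum_val k)) /=; last exact/onW_bij/enum_val_bij.
  by apply: eq_bigr => k _; rewrite !mxE enum_valK enum_rankK.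
pose Q := map_mx (@polyC R) P.
have detQ : \det Q != 0 by rewrite det_map_mx polyC_eq0.
(* [P] may fail to be invertible over [R]; its nonzero determinant is cancelled among polynomials
   instead. *)
have cM : char_poly_mx M *m Q = Q *m char_poly_mx D.
  rewrite /char_poly_mx mulmxBl mulmxBr -!map_mxM /= MP.
  by rewrite mul_scalar_mx mul_mx_scalar.
have cpE : char_poly M = char_poly D.
  apply: (mulIf detQ); rewrite /char_poly -[LHS]det_mulmx cM det_mulmx.
  by rewrite mulrC.
rewrite cpE char_poly_trig ?diag_mx_is_trig //.
rewrite (reindex (fun k : 'I_#|T| => enum_val k)) /=; last exact/onW_bij/enum_val_bij.
by apply: eq_bigr => k _; rewrite !mxE eqxx mulr1n.
Qed.

(** * Laplacians with weights constant on classes *)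

Section Quotient.
Variables (R : idomainType) (T K : finType) (cl : T -> K) (rep : K -> T).
Hypothesis repK : cancel rep cl.
Variables (w : K -> K -> R) (g : K -> K -> R) (lam : K -> R).

Let N k : R := #|[pred x | cl x == k]|%:R.
Let tr k := \sum_l N l * w k l.

Hypothesis eig_g : forall k l, \sum_m N m * (w l m * (g k l - g k m)) = lam k * g k l.
Hypothesis inj_g : forall u : K -> R,
  (forall k, \sum_l N l * (u l * g k l) = 0) -> forall l, u l = 0.

Lemma sum_class (F : K -> R) : \sum_x F (cl x) = \sum_k N k * F k.
Proof.
rewrite (partition_big cl xpredT) //=; apply: eq_bigr => k _.
rewrite (eq_bigr (fun=> F k)) => [|x /eqP-> //].
by rewrite sumr_const -mulr_natl.
Qed.

(** Indexing by [T] itself keeps the family square: a class of size N supplies one lifted class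
    function, stored at its representative, and N - 1 twin differences. *)
Definition class_eigenvector (x y : T) : R :=
  if x == rep (cl x) then g (cl x) (cl y)
  else (y == x)%:R - (y == rep (cl x))%:R.

Lemma sum_delta (F : T -> R) x : \sum_y F y * (y == x)%:R = F x.
Proof.
rewrite (bigD1 x) //= eqxx mulr1 big1 ?addr0 // => y /negPf->.
by rewrite mulr0.
Qed.

(** The [w] part kills twin differences, since its entries depend on classes only, and leaves the
    eigenvalue [tr k]; on lifted class functions the matrix acts as in [eig_g]. *)
Lemma char_poly_class_laplacian :
  char_poly (\matrix_(i, j) ((i == j)%:R * tr (cl (enum_val i))
     - w (cl (enum_val i)) (cl (enum_val j))) : 'M_#|T|)
  = \prod_k (('X - (lam k)%:P) * ('X - (tr k)%:P) ^+ #|[pred x | cl x == k]|.-1).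
Proof.
pose A z y := (z == y)%:R * tr (cl z) - w (cl z) (cl y).
pose lamT x := if x == rep (cl x) then lam (cl x) else tr (cl x).
have -> : (\matrix_(i, j) ((i == j)%:R * tr (cl (enum_val i))
     - w (cl (enum_val i)) (cl (enum_val j))) : 'M_#|T|)
   = \matrix_(i, j) A (enum_val i) (enum_val j).
  by apply/matrixP=> i j; rewrite !mxE /A (inj_eq enum_val_inj).
rewrite (@char_poly_eigenbasis _ _ A class_eigenvector lamT).
- rewrite (partition_big cl xpredT) //=; apply: eq_bigr => k _.
  rewrite (bigD1 (rep k)) ?repK //= /lamT repK eqxx; congr (_ * _).
  rewrite (eq_bigr (fun=> 'X - (tr k)%:P)) => [|x /andP[/eqP<- /negPf-> //]].
  rewrite prodr_const; congr (_ ^+ _).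
  rewrite [in RHS](cardD1 (rep k)) inE repK eqxx /=.
  by apply: eq_card => x; rewrite !inE andbC.
- move=> x z; rewrite /class_eigenvector /lamT /A.
  case: ifP => [_|nrep].
    rewrite -eig_g -(sum_class (fun m => w (cl z) m * (g (cl x) (cl z) - g (cl x) m))).
    rewrite (eq_bigr (fun y => tr (cl z) * g (cl x) (cl y) * (y == z)%:R
                               - w (cl z) (cl y) * g (cl x) (cl y))).
      rewrite big_split /= sum_delta sumrN /tr.
      rewrite -(sum_class (w (cl z))) mulr_suml -sumrB.
      by apply: eq_bigr => y _; rewrite mulrBr.
    by move=> y _; rewrite eq_sym; ring.
  rewrite (eq_bigr (fun y => ((z == y)%:R * tr (cl z) - w (cl z) (cl y)) * (y == x)%:R -
     ((z == y)%:R * tr (cl z) - w (cl z) (cl y)) * (y == rep (cl x))%:R));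
    last by move=> y _; rewrite mulrBr.
  rewrite sumrB !sum_delta repK.
  have [->|_] := eqVneq z x; first by case: eqP => _; ring.
  by have [->|_] := eqVneq z (rep (cl x)); rewrite ?repK; ring.
move=> u uV.
(* Orthogonality to twin differences makes [u] constant on classes, so that [inj_g] applies. *)
have uE x : u x = u (rep (cl x)).
  have [E|nrep] := eqVneq x (rep (cl x)); first by rewrite -E.
  apply/eqP; rewrite -subr_eq0 -(sum_delta u) -(sum_delta u (rep _)) -sumrB; apply/eqP.
  rewrite -[RHS](uV x); apply: eq_bigr => y _.
  by rewrite /class_eigenvector (negPf nrep) mulrBr.
move=> y; rewrite uE; apply: (inj_g (u := u \o rep)) => k.
rewrite -(sum_class (fun l => _ l * g k l)) -[RHS](uV (rep k)).
by apply: eq_bigr => x _; rewrite /class_eigenvector repK eqxx /= -uE.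
Qed.

End Quotient.

(** * Distances in power graphs *)

Section PowerGraphDistance.
Variable gT : finGroupType.
Implicit Types x y : gT.

Lemma pos_powerE x y : pos_power x y = (y \in <[x]>%g).
Proof.
apply/pos_powerP/cycleP=> [[i _ ->]|[i ->]]; first by exists i.
exists (i + #[x]%g)%N; first by rewrite addn_gt0 order_gt0 orbT.
by rewrite expgD expg_order mulg1.
Qed.

(** The identity is a power of every element, so it joins any two non-adjacent elements. *)
Lemma gdist_power_graph x y :
  gdist (@power_graph gT) x y =
    if x == y then 0%N
    else if pos_power x y || pos_power y x then 1%N else 2%N.
Proof.
have [<-|neq_xy] := eqVneq x y.
  by apply/eqP; rewrite -leqn0 (@gdist_min _ _ x x [::]).
have [w [wP wl ws]] := gdist_walk (power_graph_connected x y).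
have to1 z : z != 1%g -> @power_graph gT z 1%g && @power_graph gT 1%g z.
  by move=> nz1; rewrite /power_graph /= nz1 eq_sym nz1 !pos_powerE group1 orbT.
case: ifPn => [adj|nadj]; apply/eqP; rewrite eqn_leq.
  rewrite (@gdist_min _ _ x y [:: y]) //= ?andbT; last first.
    by rewrite /power_graph /= neq_xy adj.
  by rewrite -ws; case: w wP wl {ws} => //= _ E; rewrite E eqxx in neq_xy.
have x1 : x != 1%g.
  by apply: contraNneq nadj => ->; rewrite !pos_powerE group1 orbT.
have y1 : y != 1%g by apply: contraNneq nadj => ->; rewrite !pos_powerE group1.
rewrite (@gdist_min _ _ x y [:: 1%g; y]) //=; last first.
  by case/andP: (to1 x x1) => -> _; case/andP: (to1 y y1) => _ ->.
rewrite -ws; case: w wP wl {ws} => [|z [|//]] /=.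
  by move=> _ E; rewrite E eqxx in neq_xy.
by rewrite andbT => + zy; rewrite zy /power_graph /= neq_xy /= (negPf nadj).
Qed.

Lemma dist_laplacian_power_graph (K : finType) (cl : gT -> K) (c : rel K) :
  reflexive c ->
  (forall x y, pos_power x y || pos_power y x = c (cl x) (cl y)) ->
  let w k l : int := 2 - (c k l)%:R in
  dist_laplacian (@power_graph gT) =
    \matrix_(i, j) ((i == j)%:R *
        (\sum_k #|[pred x | cl x == k]|%:R * w (cl (enum_val i)) k)
       - w (cl (enum_val i)) (cl (enum_val j))).
Proof.
move=> c_refl cP w.
(* [w] is 1 on the diagonal, where the distance is 0; the correction enters both the transmissions
   and the distance matrix and cancels in their difference. *)
have dE x y : (gdist (@power_graph gT) x y)%:Z = w (cl x) (cl y) - (y == x)%:R.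
  rewrite gdist_power_graph cP eq_sym /w; have [->|] := eqVneq y x.
    by rewrite c_refl.
  by case: (c _ _).
apply/matrixP=> i j; rewrite !mxE dE (inj_eq enum_val_inj) eq_sym.
rewrite -(sum_class _ (w (cl (enum_val i)))) /transmission -natz natr_sum.
rewrite (eq_bigr (fun y => w (cl (enum_val i)) (cl y) - (1 * (y == enum_val i)%:R))).
  by rewrite sumrB (sum_delta (fun=> 1)); case: (j == i); rewrite ?mulr0n ?mulr1n; ring.
by move=> y _; rewrite natz dE mul1r.
Qed.

End PowerGraphDistance.

(** * Coordinates on the group *)

Section CyclicProduct.
Variable p : nat.
Hypothesis hp : prime p.
Let gT : finGroupType := ('Z_p * 'Z_(p ^ 2))%type.
Implicit Types x y : gT.

Let p_gt1 : (1 < p)%N. Proof. exact: prime_gt1. Qed.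
Let p_gt0 : (0 < p)%N. Proof. exact: prime_gt0. Qed.
Let p2_gt1 : (1 < p ^ 2)%N. Proof. by rewrite (@ltn_exp2l p 0). Qed.

(* The elements (a, b) have coordinates a, b modulo p and b %/ p. *)
Definition res (n : nat) : 'F_p := n%:R.
Definition ca x := res x.1.
Definition cb x := res x.2.
Definition cd x := res (x.2 %/ p).

Lemma res_eq m n : (res m == res n) = (m == n %[mod p]).
Proof. by rewrite -val_eqE /= !val_Fp_nat. Qed.

Lemma res_mod m : res (m %% p) = res m.
Proof. by apply/eqP; rewrite res_eq modn_mod. Qed.

Lemma res_modp2 m : res (m %% p ^ 2) = res m.
Proof. by apply/eqP; rewrite res_eq modn_dvdm // dvdn_exp. Qed.

Lemma resM m n : res (m * n) = res m * res n.
Proof. exact: natrM. Qed.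

Lemma res_val (a : 'F_p) : res a = a.
Proof. exact: natr_Zp. Qed.

Lemma expg1_mulrn x i : (x ^+ i)%g.1 = x.1 *+ i.
Proof. by elim: i => // i IH; rewrite expgS mulrS /= IH. Qed.

Lemma expg1E x i : (x ^+ i)%g.1 = (x.1 * i %% p)%N :> nat.
Proof. by rewrite expg1_mulrn Zp_mulrn /=; congr (_ %% _)%N; apply: Zp_cast. Qed.

Lemma expg2_mulrn x i : (x ^+ i)%g.2 = x.2 *+ i.
Proof. by elim: i => // i IH; rewrite expgS mulrS /= IH. Qed.

Lemma expg2E x i : (x ^+ i)%g.2 = (x.2 * i %% p ^ 2)%N :> nat.
Proof. by rewrite expg2_mulrn Zp_mulrn /=; congr (_ %% _)%N; apply: Zp_cast. Qed.

Lemma ca_exp x i : ca (x ^+ i)%g = ca x * res i.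
Proof. by rewrite /ca expg1E res_mod resM. Qed.

Lemma cb_exp x i : cb (x ^+ i)%g = cb x * res i.
Proof. by rewrite /cb expg2E res_modp2 resM. Qed.

Lemma cb_eq0 x : (cb x == 0) = (p %| x.2)%N.
Proof. by rewrite /cb -[0]/(res 0) res_eq mod0n. Qed.

(** The lower digit is 0, so no carry reaches the upper one. *)
Lemma cd_exp x i : cb x = 0 -> cd (x ^+ i)%g = cd x * res i.
Proof.
move/eqP; rewrite cb_eq0 => /dvdnP[k xE].
rewrite /cd expg2E xE mulnK // mulnAC -mulnA mulnC -mulnA mulnC -mulnA.
by rewrite -muln_modr mulKn // res_mod resM mulrC.
Qed.

Definition coord x := (ca x, cb x, cd x).

Lemma ltn_fst x : (x.1 < p)%N.
Proof. by rewrite -[ltnRHS](Zp_cast p_gt1). Qed.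

Lemma ltn_snd x : (x.2 < p ^ 2)%N.
Proof. by rewrite -[ltnRHS](Zp_cast p2_gt1). Qed.

Lemma coord_inj : injective coord.
Proof.
move=> x y [/eqP]; rewrite res_eq !modn_small ?ltn_fst // => /eqP a.
move=> /eqP; rewrite res_eq => /eqP b /eqP.
rewrite res_eq !modn_small ?ltn_divLR ?ltn_snd // => /eqP d.
rewrite [x]surjective_pairing [y]surjective_pairing.
congr (_, _); apply: val_inj => //=; move: b d.
move: (nat_of_ord x.2) (nat_of_ord y.2) => m n b d.
by rewrite (divn_eq m p) (divn_eq n p) d b.
Qed.

Lemma card_Zp_Zp2 : #|{: gT}| = (p ^ 3)%N.
Proof. by rewrite card_prod !card_ord !Zp_cast // -expnS. Qed.

Lemma coord_bij : bijective coord.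
Proof.
apply: (inj_card_bij coord_inj); apply: leq_trans (eq_leq (esym card_Zp_Zp2)).
by rewrite !card_prod !card_Fp // !expnS muln1 mulnA.
Qed.

(** * Cyclic subgroups and their comparability *)

(* A cyclic subgroup is the class of its generators: [inl false] is trivial,  *)
(* [inl true] is the p-th power of the group, the [inr (inl i)] are the other *)
(* subgroups of order p and the [inr (inr j)] those of order p^2.             *)
Definition cyc_class := (bool + ('F_p + 'F_p))%type.

(** Generators of one cyclic subgroup share these ratios. For b nonzero the digit d is free:
    exponents congruent to 1 modulo p move it through all values and fix a and b. *)
Definition class_of_coord (t : 'F_p * 'F_p * 'F_p) : cyc_class :=
  let: (a, b, d) := t in
  if b != 0 then inr (inr (a / b))
  else if a != 0 then inr (inl (d / a)) else inl (d != 0).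

Definition cl x := class_of_coord (coord x).

Definition comparable_class (k l : cyc_class) : bool :=
  match k, l with
  | inl false, _ | _, inl false => true
  | inl true, inl true | inl true, inr (inr _) | inr (inr _), inl true => true
  | inr (inl i), inr (inl j) | inr (inr i), inr (inr j) => i == j
  | _, _ => false
  end.

Lemma comparable_class_refl : reflexive comparable_class.
Proof. by case=> [[]|[]] //= i. Qed.

Lemma comparable_classC : symmetric comparable_class.
Proof. by case=> [[]|[] i] [[]|[] j] //=. Qed.

Lemma pos_power_coord x y : pos_power x y ->
  exists i, [/\ ca y = ca x * i, cb y = cb x * i & cb x = 0 -> cd y = cd x * i].
Proof.
rewrite pos_powerE => /cycleP[i ->]; exists (res i).
by rewrite ca_exp cb_exp; split=> // /cd_exp.
Qed.

(** A factor i nonzero modulo p preserves the ratios, hence the class; for i = 0 an element with b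
    nonzero drops to C or the identity, any other to the identity. *)
Lemma pos_power_comparable x y : pos_power x y -> comparable_class (cl x) (cl y).
Proof.
case/pos_power_coord=> i [aE bE dE]; rewrite /cl /coord /class_of_coord.
case: (eqVneq (cb x) 0) bE dE => /= [->|nz_b] bE dE; last first.
  have [i0|nz_i] := eqVneq i 0.
    by rewrite bE aE i0 !mulr0 eqxx /=; case: (cd y == 0).
  by rewrite bE mulf_neq0 //= aE -mulf_div divff // mulr1.
rewrite bE mul0r eqxx aE dE //=.
have [->|nz_a] /= := eqVneq (ca x) 0.
  by case: (cd x != 0); case: (cd x * i != 0).
have [->|nz_i] := eqVneq i 0; first by rewrite !mulr0 eqxx.
by rewrite mulf_neq0 //= -mulf_div divff // mulr1.
Qed.

Lemma pos_power_coord0 x y i : cb x = 0 -> cb y = 0 ->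
  ca y = ca x * i -> cd y = cd x * i -> pos_power x y.
Proof.
move=> bx0 by0 aE dE; rewrite pos_powerE; apply/cycleP; exists i.
by apply: coord_inj; rewrite /coord ca_exp cb_exp cd_exp // res_val bx0 by0 aE dE mul0r.
Qed.

(** The second component of [x] is a unit modulo p ^ 2, so the exponent is the quotient of second
    components; proportionality settles the first ones. *)
Lemma pos_power_coordN0 x y : cb x != 0 -> ca y * cb x = ca x * cb y -> pos_power x y.
Proof.
move=> nz_b abE; rewrite pos_powerE; apply/cycleP.
have x2U : (x.2 : 'Z_(p ^ 2)) \is a GRing.unit.
  rewrite -(natr_Zp x.2).
  rewrite (unitZpE _ p2_gt1).
  rewrite coprimeXl //.
  by rewrite prime_coprime // -cb_eq0.
pose i : nat := (y.2 / x.2 : 'Z_(p ^ 2)); exists i.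
have E2 : y.2 = (x ^+ i)%g.2.
  by rewrite expg2_mulrn -mulr_natr natr_Zp mulrC divrK.
have bE : cb y = cb x * res i by rewrite /cb E2 -/(cb _) cb_exp.
have aE : ca y = ca (x ^+ i)%g.
  by apply: (mulIf nz_b); rewrite abE bE ca_exp; ring.
by apply: coord_inj; rewrite /coord aE /cb /cd E2.
Qed.

Lemma comparable_pos_power x y : comparable_class (cl x) (cl y) ->
  pos_power x y || pos_power y x.
Proof.
rewrite /cl /coord /class_of_coord.
have [bx|bx] /= := eqVneq (cb x) 0; have [by_|by_] /= := eqVneq (cb y) 0.
- have [ax|ax] /= := eqVneq (ca x) 0; have [ay|ay] /= := eqVneq (ca y) 0.
  (* Both lie in C or are trivial: a trivial [x] is the power of [y] with exponent 0, otherwise the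
     exponent is the quotient of the digits. *)
  + have [dx|dx] /= := eqVneq (cd x) 0 => _; apply/orP; [right|left].
      by apply: (@pos_power_coord0 _ _ 0); rewrite ?mulr0.
    by apply: (@pos_power_coord0 _ _ (cd y / cd x)); rewrite // ?ax ?ay ?mul0r // mulrC divfK.
  + have [dx|//] := eqVneq (cd x) 0 => _; apply/orP; right.
    by apply: (@pos_power_coord0 _ _ 0); rewrite ?mulr0.
  + have [dx|//] := eqVneq (cd y) 0 => _; apply/orP; left.
    by apply: (@pos_power_coord0 _ _ 0); rewrite ?mulr0.
  move=> /eqP E; apply/orP; left.
  apply: (@pos_power_coord0 _ _ (ca y / ca x)) => //; first by field.
  by rewrite -[cd y](divfK ay) -E; field.
- case: ifP => [//|/negbFE/eqP ax] _; apply/orP; right.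
  by apply: pos_power_coordN0; rewrite // ax bx mul0r mulr0.
- case: ifP => [//|/negbFE/eqP ay] _; apply/orP; left.
  by apply: pos_power_coordN0; rewrite // ay by_ mul0r mulr0.
move=> /eqP E; apply/orP; left; apply: pos_power_coordN0 => //.
by rewrite -[ca y](divfK by_) -E; field.
Qed.

Lemma comparable_classP x y :
  pos_power x y || pos_power y x = comparable_class (cl x) (cl y).
Proof.
apply/idP/idP; last exact: comparable_pos_power.
by case/orP=> /pos_power_comparable //; rewrite comparable_classC.
Qed.

(** * Representatives and sizes of the classes *)

Definition class_coord (k : cyc_class) : 'F_p * 'F_p * 'F_p :=
  match k with
  | inl b => (0, 0, b%:R)
  | inr (inl i) => (1, 0, i)
  | inr (inr j) => (j, 1, 0)
  end.

Lemma class_coordK : cancel class_coord class_of_coord.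
Proof. by case=> [[]|[] i]; rewrite /= ?eqxx ?oner_eq0 /= ?divr1. Qed.

Lemma exists_class_rep : exists rep : cyc_class -> gT, cancel rep cl.
Proof.
have [f fK Kf] := coord_bij; exists (f \o class_coord) => k.
by apply: etrans (class_coordK k); congr class_of_coord; apply: Kf.
Qed.

Lemma card_class_coord k :
  #|[pred x | cl x == k]| = #|[set t | class_of_coord t == k]|.
Proof.
rewrite -(on_card_preimset (onW_bij _ coord_bij)).
by apply: eq_card => x; rewrite !inE.
Qed.

Lemma card_class1 : #|[pred x | cl x == inl false]| = 1%N.
Proof.
rewrite card_class_coord; apply/eqP/cards1P; exists (0, 0, 0).
apply/setP=> -[[a b] d]; rewrite !inE !xpair_eqE /=.
by case: (b == 0); case: (a == 0); case: (d == 0).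
Qed.

Lemma card_class0 : #|[pred x | cl x == inl true]| = p.-1.
Proof.
rewrite card_class_coord -[in RHS](card_Fp hp) -(cardsC1 (0 : 'F_p)).
rewrite -(card_imset _ (f := fun d : 'F_p => (0 : 'F_p, 0 : 'F_p, d)));
  last by move=> ? ? [].
apply: eq_card => -[[a b] d]; rewrite !inE /=.
apply/idP/imsetP=> [|[d' + [-> -> ->]]]; last by rewrite !inE eqxx /= => ->.
have [->|//] := eqVneq b 0; have [->|//] := eqVneq a 0 => /= E.
by exists d; rewrite ?inE //; case: (d != 0) E.
Qed.

Lemma card_classB i : #|[pred x | cl x == inr (inl i)]| = p.-1.
Proof.
rewrite card_class_coord -[in RHS](card_Fp hp) -(cardsC1 (0 : 'F_p)).
rewrite -(card_imset _ (f := fun a : 'F_p => (a, 0 : 'F_p, i * a)));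
  last by move=> ? ? [].
apply: eq_card => -[[a b] d]; rewrite !inE /=.
apply/idP/imsetP=> [|[a' + [-> -> ->]]]; last first.
  by rewrite !inE eqxx /= => nz_a; rewrite nz_a mulfK.
have [->|//] := eqVneq b 0; have [//|nz_a] := eqVneq a 0 => /eqP[<-].
by exists a; rewrite ?inE // divfK.
Qed.

(** The ratio j forces a = j b, leaving b nonzero and d arbitrary. *)
Lemma card_classE j : #|[pred x | cl x == inr (inr j)]| = (p.-1 * p)%N.
Proof.
rewrite card_class_coord -[in RHS](card_Fp hp) -[X in (X * _)%N](cardsC1 (0 : 'F_p)).
rewrite -cardsT -cardsX.
rewrite -(card_imset _ (f := fun t : 'F_p * 'F_p => (j * t.1, t.1, t.2)));
  last by move=> [? ?] [? ?] [_ -> ->].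
apply: eq_card => -[[a b] d]; rewrite !inE /=.
apply/idP/imsetP=> [|[[b' d'] + [-> -> ->]]]; last first.
  by rewrite !inE andbT /= => nz_b; rewrite nz_b mulfK.
have [_|nz_b /eqP[<-]] /= := eqVneq b 0; first by case: ifP.
by exists (b, d); rewrite ?inE ?nz_b //= divfK.
Qed.

(** * Spectrum on class functions *)

Let q : int := p%:Z.

Definition class_size (k : cyc_class) : int := #|[pred x | cl x == k]|%:R.

Definition class_dist (k l : cyc_class) : int := 2 - (comparable_class k l)%:R.

Let pred_pE : (p.-1)%:R = q - 1 :> int.
Proof. by rewrite -subn1 natrB // /q natz. Qed.

Lemma sum_class_size (F : cyc_class -> int) :
  \sum_k class_size k * F k =
    F (inl false) + (q - 1) * F (inl true)
    + (q - 1) * (\sum_i F (inr (inl i))) + q * (q - 1) * (\sum_j F (inr (inr j))).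
Proof.
rewrite big_sumType big_bool big_sumType /= !mulr_sumr addrA; congr (_ + _ + _).
- by rewrite /class_size card_class1 card_class0 pred_pE mul1r addrC.
- by apply: eq_bigr => i _; rewrite /class_size card_classB pred_pE.
- apply: eq_bigr => j _; rewrite /class_size card_classE natrM pred_pE /q.
  by rewrite natz [RHS]mulrAC [_ * q]mulrC mulrAC.
Qed.

Lemma sum_Fp (c : int) : \sum_(i : 'F_p) c = q * c.
Proof. by rewrite sumr_const card_Fp // -mulr_natl natz. Qed.

Lemma sum_Fp_delta (F : 'F_p -> int) j : \sum_i (j == i)%:R * F i = F j.
Proof.
rewrite (bigD1 j) //= eqxx mul1r big1 ?addr0 // => i /negPf.
by rewrite eq_sym => ->; rewrite mul0r.
Qed.

Lemma sum_Fp_scale (a c : int) (F : 'F_p -> int) :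
  \sum_j a * (c - F j) = a * (q * c - \sum_j F j).
Proof. by rewrite -mulr_sumr sumrB sum_Fp. Qed.

Lemma sum_Fp_dist (c : int) (F : 'F_p -> int) i :
  \sum_j (2 - (i == j)%:R) * (c - F j) = 2 * (q * c - \sum_j F j) - (c - F i).
Proof.
rewrite -sum_Fp_scale -[c - F i](sum_Fp_delta (fun j => c - F j)) -sumrB.
by apply: eq_bigr => j _; rewrite mulrBl.
Qed.

(* [2 n I - 2 J] minus the combinatorial Laplacian, with n = p ^ 3. *)
Lemma class_dist_laplacian (u : cyc_class -> int) l :
  \sum_m class_size m * (class_dist l m * (u l - u m)) =
    2 * (q ^+ 3 * u l - \sum_m class_size m * u m)
    - match l with
      | inl false => q ^+ 3 * u l - \sum_m class_size m * u m
      | inl true => (q ^+ 3 - q ^+ 2 + q) * u l - u (inl false) - (q - 1) * u l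
                    - q * (q - 1) * \sum_j u (inr (inr j))
      | inr (inl _) => u l - u (inl false)
      | inr (inr _) => q * u l - u (inl false) - (q - 1) * u (inl true)
      end.
Proof.
rewrite !sum_class_size /class_dist.
by case: l => [[]|[] i] /=; rewrite ?sum_Fp_dist !sum_Fp_scale; ring.
Qed.

(* For [inr (inl i)] and [inr (inr j)], j != 0: differences of normalised      *)
(* indicators of sibling subtrees; the slot [inr (inr 0)] left free by the    *)
(* latter hosts the function separating C from the subtree above it.          *)
Definition class_eigenfun (k l : cyc_class) : int :=
  match k with
  | inl false => 1
  | inl true => if l is inl false then q ^+ 3 - 1 else -1
  | inr (inl i) =>
      match l with
      | inl false => 0
      | inr (inl i') => (i == i')%:R * (q ^+ 2 + 1)
      | _ => -1
      end
  | inr (inr j) =>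
      match l with
      | inl true => (j == 0)%:R * q ^+ 2
      | inr (inr j') => if j == 0 then -1 else (j == j')%:R - (0 == j')%:R
      | _ => 0
      end
  end.

Definition class_eigenvalue (k : cyc_class) : int :=
  match k with
  | inl false => 0
  | inl true => q ^+ 3
  | inr (inl _) => 2 * q ^+ 3 - 1
  | inr (inr j) => if j == 0 then q ^+ 3 + q ^+ 2 - q else 2 * q ^+ 3 - q
  end.

Lemma sum_Fp_delta1 (c : int) j : \sum_(i : 'F_p) (j == i)%:R * c = c.
Proof. exact: (sum_Fp_delta (fun=> c)). Qed.

Lemma class_eigenfunP k l :
  \sum_m class_size m * (class_dist l m * (class_eigenfun k l - class_eigenfun k m))
  = class_eigenvalue k * class_eigenfun k l.
Proof.
rewrite class_dist_laplacian sum_class_size.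
have delta1 j : \sum_(i : 'F_p) (j == i)%:R = 1 :> int.
  by under eq_bigr do rewrite -[_%:R]mulr1; rewrite sum_Fp_delta1.
case: k => [[]|[] i]; rewrite /= ?sum_Fp ?sum_Fp_delta1.
- by case: l => [[]|[] ?]; ring.
- by case: l => [[]|[] ?]; ring.
- by case: l => [[]|[] j]; ring.
have [_|nz_i] := eqVneq i 0; rewrite ?mulr1n ?mulr0n ?sum_Fp ?sumrB ?delta1.
  by case: l => [[]|[] j]; ring.
by case: l => [[]|[] j]; ring.
Qed.

(** Differences of siblings force one value e of [u] on the E_j, then on C, then on the B_i. The
    constant function and the one separating the identity give two relations between e and the value
    at the identity, whence (n - 1) n e = 0 with n = p ^ 3. *)
Lemma class_eigenfun_inj (u : cyc_class -> int) :
  (forall k, \sum_l class_size l * (u l * class_eigenfun k l) = 0) -> forall l, u l = 0.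
Proof.
move=> uP.
have q_gt1 : 1 < q by rewrite /q ltz_nat.
have q0 : q != 0 by lia.
have q1 : q - 1 != 0 by lia.
set e := u (inr (inr 0)).
have uE j : u (inr (inr j)) = e.
  have [->//|nz_j] := eqVneq j 0.
  have := uP (inr (inr j)); rewrite sum_class_size /= (negPf nz_j) mulr0n mul0r !mulr0.
  rewrite big1 => [|i _]; last by rewrite mulr0.
  under eq_bigr do rewrite mulrBr ![u _ * _]mulrC.
  rewrite sumrB !sum_Fp_delta mulr0 !add0r => /eqP.
  by rewrite !mulf_eq0 (negPf q0) (negPf q1) /= subr_eq0 => /eqP.
have u0 : u (inl true) = e.
  have := uP (inr (inr 0)); rewrite sum_class_size /= ?eqxx ?mulr1n.
  rewrite big1 => [|i _]; last by rewrite mulr0.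
  under eq_bigr do rewrite uE; rewrite sum_Fp => E.
  have : (q - 1) * q ^+ 2 * (u (inl true) - e) = 0 by rewrite -[RHS]E; ring.
  move/eqP; rewrite !mulf_eq0 (negPf q0) (negPf q1) /= subr_eq0 => /eqP //.
have uB i : u (inr (inl i)) = e.
  have := uP (inr (inl i)); rewrite sum_class_size /= u0.
  under [X in _ + _ + _ * X]eq_bigr do rewrite uE.
  under eq_bigr do rewrite mulrCA; rewrite sum_Fp_delta sum_Fp => E.
  have : (q - 1) * (q ^+ 2 + 1) * (u (inr (inl i)) - e) = 0 by rewrite -[RHS]E; ring.
  move/eqP; rewrite !mulf_eq0 (negPf q1) /= subr_eq0 => /orP[|/eqP //].
  nia.
have S1 : u (inl false) + (q ^+ 3 - 1) * e = 0.
  rewrite -[RHS](uP (inl false)) sum_class_size /= u0.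
  under eq_bigr do rewrite uB; under [X in _ + _ + _ * X]eq_bigr do rewrite uE.
  by rewrite !sum_Fp; ring.
have S2 : (q ^+ 3 - 1) * (u (inl false) - e) = 0.
  rewrite -[RHS](uP (inl true)) sum_class_size /= u0.
  under eq_bigr do rewrite uB; under [X in _ + _ + _ * X]eq_bigr do rewrite uE.
  by rewrite !sum_Fp; ring.
have e0 : e = 0.
  have : (q ^+ 3 - 1) * q ^+ 3 * e = 0.
    have -> : (q ^+ 3 - 1) * q ^+ 3 * e =
       (q ^+ 3 - 1) * (u (inl false) + (q ^+ 3 - 1) * e)
                - (q ^+ 3 - 1) * (u (inl false) - e) by ring.
    by rewrite S1 S2 mulr0 subr0.
  by move/eqP; rewrite !mulf_eq0 (negPf q0) /= orbF => /orP[|/eqP //]; nia.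
move: S1; rewrite e0 mulr0 addr0 => u1.
by case=> [[]|[] i]; rewrite ?u1 ?u0 ?uB ?uE.
Qed.

(** Each value is 2 p ^ 3 minus the number of elements comparable to the class: p ^ 3, p ^ 3 - p ^ 2
    + p, p and p ^ 2 respectively. *)
Lemma class_dist_sum k : \sum_l class_size l * class_dist k l =
  match k with
  | inl false => q ^+ 3
  | inl true => q ^+ 3 + q ^+ 2 - q
  | inr (inl _) => 2 * q ^+ 3 - q
  | inr (inr _) => 2 * q ^+ 3 - q ^+ 2
  end.
Proof.
have sumE (i : 'F_p) : \sum_(j : 'F_p) (2 - (i == j)%:R : int) = 2 * q - 1.
  rewrite -[X in _ - X](sum_Fp_delta1 1 i) mulrC -sum_Fp -sumrB.
  by apply: eq_bigr => j _; rewrite mulr1.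
rewrite sum_class_size /class_dist.
by case: k => [[]|[] i] /=; rewrite ?sumE !sum_Fp; ring.
Qed.

(** * Assembling the characteristic polynomial *)

Lemma char_poly_power_graph :
  char_poly (dist_laplacian (@power_graph gT)) =
    'X * ('X - (q ^+ 3)%:P)
    * ('X - (2 * q ^+ 3 - q)%:P) ^+ (p ^ 2 - p - 1)
    * ('X - (q ^+ 3 + q ^+ 2 - q)%:P) ^+ (p - 1)
    * ('X - (2 * q ^+ 3 - q ^+ 2)%:P) ^+ (p * (p ^ 2 - p - 1))
    * ('X - (2 * q ^+ 3 - 1)%:P) ^+ p.
Proof.
have [rep repK] := exists_class_rep.
rewrite (dist_laplacian_power_graph comparable_class_refl comparable_classP).
rewrite (char_poly_class_laplacian repK class_eigenfunP class_eigenfun_inj).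
rewrite big_sumType big_bool big_sumType /=.
rewrite -/(class_size _) !class_dist_sum card_class1 card_class0 expr0 mulr1 subr0.
under eq_bigr => i _ do rewrite class_dist_sum card_classB.
under [X in _ * (_ * X)]eq_bigr => j _ do rewrite class_dist_sum card_classE.
rewrite prodr_const card_Fp // big_split /= prodr_const card_Fp //.
(* The slot j = 0 holds the eigenvalue separating C from the E_j; the other p - 1 slots hold
   differences of the E_j. *)
rewrite (bigD1 0) //= (eq_bigr (fun=> 'X - (2 * q ^+ 3 - q)%:P)) => [|j /negPf-> //].
rewrite prodr_const (_ : #|_| = p.-1); last first.
  by rewrite -[in RHS](card_Fp hp) -(cardC1 (0 : 'F_p)).
have -> : (p ^ 2 - p - 1 = p.-2 * p + p.-1)%N by nia.
have -> : (p - 1 = p.-2.+1)%N by lia.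
have -> : (p * (p.-2 * p + p.-1) = (p.-1 * p).-1 * p)%N by nia.
move: ('X - (2 * q ^+ 3 - q)%:P) ('X - (q ^+ 3 + q ^+ 2 - q)%:P) => A B.
by rewrite exprMn exprD -!exprM [B ^+ _.+1]exprS; ring.
Qed.

End CyclicProduct.

Lemma dist_laplacian_char_polyE (T : finType) (e : rel T) :
  dist_laplacian_char_poly e = (-1) ^+ #|T| * char_poly (dist_laplacian e).
Proof. by rewrite /dist_laplacian_char_poly -opprB -scaleN1r detZ. Qed.

Theorem theorem2p6 (p : nat) (hp : prime p) :
  let G : rel ('Z_p * 'Z_(p ^ 2)) := @power_graph ('Z_p * 'Z_(p ^ 2))%type in
  let q : int := p%:Z in
  let P : {poly int} :=
    'X * ('X - (q ^+ 3)%:P)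
    * ('X - (2 * q ^+ 3 - q)%:P) ^+ (p ^ 2 - p - 1)
    * ('X - (q ^+ 3 + q ^+ 2 - q)%:P) ^+ (p - 1)
    * ('X - (2 * q ^+ 3 - q ^+ 2)%:P) ^+ (p * (p ^ 2 - p - 1))
    * ('X - (2 * q ^+ 3 - 1)%:P) ^+ p in
  dist_laplacian_char_poly G = (-1) ^+ (p ^ 3) * P
  /\ char_poly (dist_laplacian G) = P.
Proof.
move=> G q P; have E : char_poly (dist_laplacian G) = P by exact: char_poly_power_graph.
split=> //; rewrite dist_laplacian_char_polyE E; congr (_ ^+ _ * _).
exact: card_Zp_Zp2.
Qed.
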